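(* Let $k$, $d$ and $n$ be positive integers such that $k \ge 6$ is even, $d \ge 2$, and $n = \frac{d+1}{8}(k^2-2sk+4s-4)$, where $s \in \{0,1\}$ with $s \equiv \frac{k-2}{2} \pmod 2$. Then a function $f:[n] \rightarrow \{-1,1\}$ satisfies $|f([n])| = \frac{d-1}{d+1}n$ and has no $(d,k)$-block $A\subseteq[n]$ with $f(A)=0$ if and only if $f \in \mathcal{F}_{d,k}$.
   Context: $[n]=\{1,\dots,n\}$; $f(Y)=\sum_{y\in Y}f(y)$. A block is a set of consecutive integers. A $(d,k)$-block in $[n]$ is a set $\{a_1<\dots<a_k\}\subseteq[n]$ with $a_{i+1}-a_i\le d$ for all $i$. With $k,d,s,n$ as in the claim, put $m=\frac{k-2s-2}{4}$, $b=(d+1)\frac{k}{2}+d-1$, $r=\frac{k}{2}-1+ds$ (so $n=mb+r$), and define $R_i=\{(i-1)b+1,\dots,(i-1)b+r\}$ for $1\le i\le m+1$ and $T_i=\{(i-1)b+\frac{k}{2}+ds,\dots,ib\}$ for $1\le i\le m$. The family $\mathcal{F}^+_{d,k}$ consists of the $f:[n]\to\{-1,1\}$ such that: (F1) if $s=0$: $f(x)=-1$ for $x\in R_i$ ($1\le i\le m+1$) and $f(x)=1$ for $x\in T_i$ ($1\le i\le m$); (F2) if $s=1$: (i) $f(T_i)=|T_i|=\frac{k}{2}d$ for all $1\le i\le m$; (ii) $f(R_i)=d-\frac{k}{2}+1$ for all $1\le i\le m+1$; and, writing $R_i(1)=f^{-1}(1)\cap R_i$ and letting $\mathcal{T}_i\subseteq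 R_i\cup T_i\cup R_{i+1}$ be the maximal block containing $T_i$ such that $f(\mathcal{T}_i)=|\mathcal{T}_i|$ (i.e. on which $f\equiv 1$), for $1\le i\le m$: (iii) if $R_i(1)$ is not a block, then $|\mathcal{T}_i\setminus T_i|\ge d$; (iv) if $R_i(1)$ is a block and $R_i\cap\mathcal{T}_i=\emptyset$, then $R_{i+1}(1)$ is a block and there are at most $\frac{k}{2}-1$ elements $x$ with $f(x)=-1$ lying between $R_i(1)$ and $R_{i+1}(1)$. Finally $\mathcal{F}^-_{d,k}=\{-f : f\in\mathcal{F}^+_{d,k}\}$ and $\mathcal{F}_{d,k}=\mathcal{F}^+_{d,k}\cup\mathcal{F}^-_{d,k}$. *)

(* Defs.v *)
(* Positions are natural numbers; f : nat -> int, and only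
   its values on [n] = {1,...,n} matter. *)
From HB Require Import structures.
From mathcomp Require Import all_boot all_order all_algebra.
Set Implicit Arguments. Unset Strict Implicit. Unset Printing Implicit Defensive.
Import Order.TTheory GRing.Theory Num.Theory.
Local Open Scope ring_scope.

Definition intv (a c : nat) : seq nat := iota a (c.+1 - a).

Definition fsum (f : nat -> int) (Y : seq nat) : int := \sum_(y <- Y) f y.

Definition is_block (S : seq nat) : Prop :=
  forall x y z : nat, x \in S -> z \in S -> (x <= y <= z)%N -> y \in S.

Definition dk_block (d k n : nat) (A : seq nat) : Prop :=
  size A = k /\ all (fun x => (1 <= x <= n)%N) A /\
  sorted (fun x y => (x < y <= x + d)%N) A.

Definition m_ (k s : nat) : nat := ((k - 2 * s - 2) %/ 4)%N.
Definition b_ (k d : nat) : nat := ((d + 1) * k %/ 2 + d - 1)%N.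
Definition r_ (k d s : nat) : nat := (k %/ 2 - 1 + d * s)%N.

Definition Rset (k d s i : nat) : seq nat :=
  intv ((i - 1) * b_ k d + 1)%N ((i - 1) * b_ k d + r_ k d s)%N.
Definition Tset (k d s i : nat) : seq nat :=
  intv ((i - 1) * b_ k d + k %/ 2 + d * s)%N (i * b_ k d)%N.

Definition F1 (k d s : nat) (f : nat -> int) : Prop :=
  (forall i, (1 <= i <= m_ k s + 1)%N -> forall x, x \in Rset k d s i -> f x = -1) /\
  (forall i, (1 <= i <= m_ k s)%N -> forall x, x \in Tset k d s i -> f x = 1).

Definition R1 (k d s : nat) (f : nat -> int) (i : nat) : seq nat :=
  [seq x <- Rset k d s i | f x == 1].

Definition Tcand (k d s : nat) (f : nat -> int) (i a c : nat) : Prop :=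
  (a <= c)%N /\
  (forall x, (a <= x <= c)%N -> x \in Rset k d s i ++ Tset k d s i ++ Rset k d s (i + 1)) /\
  (forall x, x \in Tset k d s i -> (a <= x <= c)%N) /\
  (forall x, (a <= x <= c)%N -> f x = 1).

Definition Tcal (k d s : nat) (f : nat -> int) (i a c : nat) : Prop :=
  Tcand k d s f i a c /\
  (forall a' c', Tcand k d s f i a' c' ->
     (forall x, (a <= x <= c)%N -> (a' <= x <= c')%N) -> intv a' c' = intv a c).

Definition F2 (k d s n : nat) (f : nat -> int) : Prop :=
  (forall i, (1 <= i <= m_ k s)%N ->
     fsum f (Tset k d s i) = (size (Tset k d s i))%:Z) /\
  (forall i, (1 <= i <= m_ k s + 1)%N ->
     fsum f (Rset k d s i) = d%:Z - (k %/ 2)%N%:Z + 1) /\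
  (forall i, (1 <= i <= m_ k s)%N -> ~ is_block (R1 k d s f i) ->
     forall a c, Tcal k d s f i a c ->
       (d <= size [seq x <- intv a c | x \notin Tset k d s i])%N) /\
  (forall i, (1 <= i <= m_ k s)%N -> is_block (R1 k d s f i) ->
     forall a c, Tcal k d s f i a c ->
       (forall x, x \in Rset k d s i -> x \notin intv a c) ->
       is_block (R1 k d s f (i + 1)) /\
       (size [seq x <- iota 1%N n | (f x == (-1)%R) &&
                 all (fun y => (y < x)%N) (R1 k d s f i) &&
                 all (fun z => (x < z)%N) (R1 k d s f (i + 1))] <= k %/ 2 - 1)%N).

Definition inFplus (k d s n : nat) (f : nat -> int) : Prop :=
  (s = 0%N -> F1 k d s f) /\ (s = 1%N -> F2 k d s n f).

Definition inF (k d s n : nat) (f : nat -> int) : Prop :=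
  inFplus k d s n f \/ inFplus k d s n (fun x => - f x).

(* Main.v *)
(** Let q = k/2, write x_1 < ... < x_M for the positions of the value -1, x_0 = 0,
    x_(M+1) = n+1, and let h_j = floor((x_(j+1) - x_j - 1) / d), the least number
    of points a chain of step at most d needs strictly between x_j and x_(j+1).
    If f has sum (d-1)n/(d+1), it has no zero-sum (d,k)-block if and only if every q-1
    consecutive inner h_j have sum at least q+1: a block with q values -1 then has
    at least q+1 values 1, and conversely a window of smaller sum gives a block with
    at least q values -1, from which discrete continuity leads to a balanced one.
    The window condition yields x_(j+q-1) >= x_j + b.  Iterating this from both
    ends of [n] pins the values -1 into the sets R_i, q-1 in each, and so the T_i
    into the gaps h_(i(q-1)).  Since T_i alone makes h_(i(q-1)) at least q+1-s, what
    remains for s = 1 is whether the missing unit comes from a run of d values 1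
    contained in R_i or R_(i+1), which is (F2)(iii)-(iv). *)
Require Import Defs.
From HB Require Import structures.
From mathcomp Require Import all_boot all_order all_algebra.
From mathcomp Require Import zify ring.
Set Implicit Arguments. Unset Strict Implicit. Unset Printing Implicit Defensive.
Import Order.TTheory GRing.Theory Num.Theory.

(** * Discrete continuity and counting in intervals *)

Section DiscreteIVT.
Local Open Scope nat_scope.

(** Steps of size at most 1 cannot pass [v] without hitting it. Applied to growing chains and to
    sliding intervals. *)
Lemma slow_avoiding_const (g : nat -> nat) (N v : nat) :
  (forall x, x < N -> g x.+1 <= (g x).+1 /\ g x <= (g x.+1).+1) ->
  (forall x, x <= N -> g x <> v) ->
  forall x, x <= N -> (v < g x) = (v < g 0).
Proof.
move=> slow avoid; elim=> [//|x IH] ltxN.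
rewrite -IH; last exact: ltnW.
by have := slow x ltxN; have := avoid _ ltxN; have := avoid x (ltnW ltxN); lia.
Qed.

Lemma count_iota_sub (P : pred nat) (a l : nat) :
  count P (iota a.+1 l) = count P (iota 1 (a + l)) - count P (iota 1 a).
Proof. by rewrite iotaD count_cat add1n addKn. Qed.

Lemma count_dvdn_iota (d a l : nat) :
  count (fun y => d %| y - a) (iota a.+1 l) = l %/ d.
Proof.
rewrite -addn1 iotaDl count_map divn_count_dvd /index_iota subn1 /=.
rewrite -big_mkcond /= sum1_count; apply: eq_count => y /=.
by rewrite addKn.
Qed.

Lemma count_lt_succ (P : pred nat) (z : nat) (s : seq nat) : uniq s ->
  count (fun y => P y || (y < z)) s <= count (fun y => P y || (y < z.+1)) s
    <= (count (fun y => P y || (y < z)) s).+1.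
Proof.
move=> us; apply/andP; split.
  by apply: sub_count => y /= /orP[->//|yz]; rewrite (leqW yz) orbT.
have le1 : count_mem z s <= 1 by rewrite count_uniq_mem //; case: (z \in s).
apply: leq_trans (_ : count (fun y => P y || (y < z)) s + count_mem z s <= _);
  last by lia.
rewrite -count_predUI; apply: leq_trans (leq_addr _ _).
by apply: sub_count => y /=; case: (P y) => //=; rewrite ltnS leq_eqVlt orbC.
Qed.

End DiscreteIVT.

(** * Positions of the marked points *)

Section Marked.
Local Open Scope nat_scope.
Variables (neg : pred nat) (n : nat).

Definition cnt (y : nat) : nat := count neg (iota 1 y).

(* Sentinels: pos 0 = 0 and pos j = n + 1 for every j > cnt n. *)
Definition pos (j : nat) : nat := nth n.+1 (0 :: [seq x <- iota 1 n | neg x]) j.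

Definition gap (d j : nat) : nat := (pos j.+1 - (pos j).+1) %/ d.

(* Only the inner gaps, numbered 1 to cnt n - 1, are constrained; Q stands for k/2 - 1. *)
Definition spread (d Q : nat) : Prop :=
  forall i, 0 < i -> i + Q <= cnt n -> Q.+1 < \sum_(i <= j < i + Q) gap d j.

Lemma cntS y : cnt y.+1 = cnt y + neg y.+1.
Proof. by rewrite /cnt -(addn1 y) iotaD count_cat /= add1n addn1 addn0. Qed.

Lemma cnt_mono x y : x <= y -> cnt x <= cnt y.
Proof. by move=> /subnKC <-; rewrite /cnt iotaD count_cat leq_addr. Qed.

Lemma cnt_iota a l : count neg (iota a.+1 l) = cnt (a + l) - cnt a.
Proof. exact: count_iota_sub. Qed.

Lemma pos0 : pos 0 = 0. Proof. by []. Qed.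

(** [pos] and [cnt] form a Galois connection, sentinels included; most facts on positions follow by
    translation into counts. *)
Lemma pos_galois j y : y <= n -> (pos j <= y) = (j <= cnt y).
Proof.
move=> yn; case: j => [//|j]; rewrite /pos /=.
rewrite -(subnKC yn) iotaD filter_cat nth_cat size_filter -/(cnt y) add1n.
case: ltnP => jc.
  have : nth (y + (n - y)).+1 [seq x <- iota 1 y | neg x] j
           \in [seq x <- iota 1 y | neg x] by rewrite mem_nth // size_filter.
  by rewrite mem_filter mem_iota => /and3P[_ _]; rewrite add1n ltnS => ->.
have [lt|ge] := ltnP (j - cnt y) (size [seq x <- iota y.+1 (n - y) | neg x]).
  have := mem_nth (y + (n - y)).+1 lt.
  by rewrite mem_filter mem_iota => /and3P[_ ylt _]; apply/negbTE; rewrite -ltnNge.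
by rewrite nth_default // subnKC // leqNgt ltnS yn.
Qed.

Lemma pos_le j : j <= cnt n -> pos j <= n.
Proof. by rewrite pos_galois. Qed.

Lemma pos_leSn j : pos j <= n.+1.
Proof.
have [/pos_le/leqW //|lt] := leqP j (cnt n).
by rewrite /pos nth_default //= size_filter.
Qed.

Lemma pos_last : pos (cnt n).+1 = n.+1.
Proof. by rewrite /pos nth_default //= size_filter. Qed.

Lemma cntK j : j <= cnt n -> cnt (pos j) = j.
Proof.
move=> jn; have pn := pos_le jn.
apply/eqP; rewrite eqn_leq -pos_galois // leqnn andbT.
case E: (pos j) => [//|p].
have : ~~ (pos j <= p) by rewrite E ltnn.
rewrite pos_galois -?ltnNge; last by rewrite E in pn; lia.
by rewrite cntS; case: (neg _); lia.
Qed.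

Lemma pos_lt i j : i < j -> i <= cnt n -> pos i < pos j.
Proof.
move=> ij ic; rewrite ltnNge pos_galois ?cntK ?pos_le // -ltnNge //.
Qed.

Lemma pos_inj i j : i <= cnt n -> j <= cnt n -> pos i = pos j -> i = j.
Proof. by move=> ic jc e; rewrite -(cntK ic) e cntK. Qed.

Lemma neg_pos j : 0 < j -> j <= cnt n -> neg (pos j).
Proof.
case: j => // j _ jn; have := cntK jn.
have : pos j.+1 > 0 by rewrite -pos0 pos_lt.
case E: (pos j.+1) => [//|p] _; rewrite cntS; case: (neg _) => //.
have : ~~ (pos j.+1 <= p) by rewrite E ltnn.
by rewrite pos_galois; have := pos_le jn; rewrite ?E; lia.
Qed.

Lemma cnt_between j y : pos j <= y < pos j.+1 -> y <= n -> cnt y = j.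
Proof. by move=> + yn; rewrite ltnNge !pos_galois // -ltnNge; lia. Qed.

Lemma pos_neg y : 0 < y <= n -> neg y -> pos (cnt y) = y.
Proof.
case: y => // y /andP[_ yn] ny; apply/eqP; rewrite eqn_leq pos_galois // leqnn /=.
by rewrite ltnNge pos_galois ?cntS ?ny; lia.
Qed.

Lemma between_notneg j y : pos j < y < pos j.+1 -> ~~ neg y.
Proof.
move=> /andP[jy yj]; have yn : y <= n by have := pos_leSn j.+1; lia.
apply/negP=> ny; have := pos_neg _ ny.
by rewrite (@cnt_between j) //; lia.
Qed.

Lemma notneg_cnt a l : (forall y, a < y <= a + l -> ~~ neg y) -> cnt (a + l) = cnt a.
Proof.
elim: l => [|l IH] H; first by rewrite addn0.
rewrite addnS cntS IH => [|y yl]; last by apply: H; lia.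
by rewrite (negbTE (H _ _)) ?addn0; lia.
Qed.

Lemma pos_stretch j u : j <= cnt n -> u <= j -> pos u + (j - u) <= pos j.
Proof.
move=> jn uj; have [t tE] : exists t, j = u + t by exists (j - u); lia.
subst j; clear uj; elim: t jn => [|t IH] jn; first by rewrite addn0 subnn addn0.
have jn' : u + t <= cnt n by lia.
have lt : pos (u + t) < pos (u + t.+1) by apply: pos_lt => //; lia.
by have := IH jn'; lia.
Qed.

End Marked.

(** * Blocks with bounded steps *)

Section Chains.
Local Open Scope nat_scope.
Variable d : nat.

Let step : rel nat := fun x y => x < y <= x + d.

Lemma chain_sorted_ltn A : sorted step A -> sorted ltn A.
Proof. by apply: sub_sorted => x y /andP[]. Qed.

(** The successor of the last chain element up to [y] lies beyond [y], at most [d] further. *)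
Lemma chain_next A y : sorted step A -> has (fun x => x <= y) A ->
  has (fun z => y < z) A -> exists2 z, z \in A & y < z <= y + d.
Proof.
case: A => [//|x A] sA lo hi.
have xy : x <= y.
  case/hasP: lo => w; rewrite inE => /orP[/eqP->//|wA] wy.
  have /(order_path_min ltn_trans)/allP/(_ w wA) := chain_sorted_ltn sA.
  by move/ltnW/leq_trans; apply.
have {lo}hi : has (fun z => y < z) A by move: hi; rewrite /= ltnNge xy.
elim: A x xy sA hi => [//|z A IH] x xy /= /andP[/andP[xz zx] pA] hi.
have [zy|yz] := leqP z y.
  move: hi; rewrite ltnNge zy /= => hi.
  have [w wA wy] := IH z zy pA hi; exists w => //.
  by move: wA; rewrite !inE orbC => /orP[->|->]; rewrite ?orbT.
by exists z; [rewrite !inE eqxx orbT | lia].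
Qed.

(** The [l] points after [a] contain [l %/ d] disjoint windows of length [d], each hit by [A]. *)
Lemma count_hits (A : seq nat) a l :
  (forall y, a <= y -> y + d <= a + l -> exists2 z, z \in A & y < z <= y + d) ->
  l %/ d <= count (mem A) (iota a.+1 l).
Proof.
move=> hits.
have H t : t * d <= l -> t <= count (mem A) (iota a.+1 (t * d)).
  elim: t => [//|t IH]; rewrite mulSn addnC => tl.
  rewrite iotaD count_cat -addn1 leq_add ?IH //; first by lia.
  rewrite -has_count; have [z zA zy] := hits (a + t * d) ltac:(lia) ltac:(lia).
  by apply/hasP; exists z => //; rewrite mem_iota; lia.
apply: leq_trans (H _ (leq_trunc_div l d)) _.
by rewrite -{2}(subnKC (leq_trunc_div l d)) iotaD count_cat leq_addr.
Qed.

Lemma chain_filter_iota (a : pred nat) lo l :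
  (forall y, lo <= y < lo + l ->
     exists2 z, a z & (y < z <= y + d) && (z <= lo + l)) ->
  sorted step [seq y <- iota lo l.+1 | a y].
Proof.
(* [p] is the last point kept and [x] the last one scanned; the point within reach of [p] must lie
   beyond [x]. *)
have H p x : p <= x -> (forall z, p < z <= x -> ~~ a z) ->
    (forall y, p <= y < x + l ->
      exists2 z, a z & (y < z <= y + d) && (z <= x + l)) ->
    path step p [seq y <- iota x.+1 l | a y].
  elim: l p x => [//|l IH] p x px none cover /=.
  have cover' y : p <= y < x.+1 + l ->
      exists2 z, a z & (y < z <= y + d) && (z <= x.+1 + l).
    by move=> yl; have := cover y; rewrite addSnnS; apply; rewrite -addSnnS.
  case: ifPn => ax /=.
    apply/andP; split.
      have [z az zp] := cover p ltac:(lia).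
      have : ~~ (p < z <= x) by apply: contraL az => /none.
      by rewrite /step; lia.
    by apply: IH => // [z|y yl]; [lia | apply: cover'; lia].
  apply: IH => [|z zx|//]; first exact: leqW.
  by have [->//|ne] := eqVneq z x.+1; apply: none; lia.
move=> cover /=.
have H2 := H lo lo (leqnn _) _ cover.
by case: ifP => _ /=; [|apply: path_sorted]; apply: H2 => z; lia.
Qed.

End Chains.

(** * Balanced blocks and sums of consecutive gaps *)

Section Blocks.
Local Open Scope nat_scope.
Variables (neg : pred nat) (n d : nat).
Hypothesis d_gt0 : 0 < d.

Let c := cnt neg.
Let x := pos neg n.

(** Between its first and last mark the block crosses at least [Q] inner gaps, and crossing the gap
    numbered [j] costs at least [gap neg n d j] unmarked elements. *)
Lemma spread_chain Q A : spread neg n d Q ->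
  sorted (fun x y => x < y <= x + d) A -> all (fun x => 1 <= x <= n) A ->
  count neg A = Q.+1 -> Q.+1 < count (predC neg) A.
Proof.
move=> spr sA inA cA; have ltA := chain_sorted_ltn sA.
have uA : uniq A := sorted_uniq ltn_trans ltnn ltA.
have rng z : z \in A -> 1 <= z <= n by move/(allP inA).
set s := [seq y <- A | neg y].
have sz : size s = Q.+1 by rewrite size_filter.
have ss : sorted ltn s by apply: sorted_filter => //; exact: ltn_trans.
have ms z : z \in s -> neg z /\ z \in A by rewrite mem_filter => /andP.
case E: s sz => [//|lo s'] [sz].
have hlo : lo \in s by rewrite E mem_head.
have hhi : last lo s' \in s by rewrite E mem_last.
set hi := last lo s' in hhi.
have [nlo Alo] := ms _ hlo; have [nhi Ahi] := ms _ hhi.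
have [rlo rhi] := (rng _ Alo, rng _ Ahi).
have slo z : z \in s -> lo <= z <= hi.
  move=> zs; have ps : path leq lo s'.
    by move: ss; rewrite E /=; apply: sub_path => ? ?; exact: ltnW.
  apply/andP; split.
    move: zs; rewrite E inE => /orP[/eqP->//|].
    by move/(allP (order_path_min leq_trans ps)).
  have := zs; rewrite E => /(nthP 0)[i il <-].
  rewrite /hi (last_nth 0); apply: (@sorted_leq_nth _ leq leq_trans leqnn 0 (lo :: s')).
  - exact: ps.
  - exact: il.
  - by rewrite inE /=.
  - exact: il.
have lohi : lo <= hi by have := slo _ hhi; lia.
have ilo : x (c lo) = lo by apply: pos_neg.
have ihi : x (c hi) = hi by apply: pos_neg.
have chn : c hi <= c n by apply: cnt_mono; lia.
have Qle : c lo + Q <= c hi.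
  have us : uniq s := sorted_uniq ltn_trans ltnn ss.
  have /(uniq_leq_size us) : {subset s <= [seq y <- iota lo.-1.+1 (hi - lo.-1) | neg y]}.
    move=> z zs; rewrite mem_filter mem_iota; have := slo _ zs.
    by have [-> _] := ms _ zs; lia.
  rewrite E /= sz size_filter cnt_iota -/c.
  have -> : lo.-1 + (hi - lo.-1) = hi by lia.
  have := cntS neg lo.-1; rewrite prednK ?nlo; last by lia.
  by rewrite -/c; lia.
(* Unmarked elements of [A] up to [y], to be telescoped from mark to mark. *)
pose pc y := count (fun z => (z \in A) && ~~ neg z) (iota 1 y).
have pc_step j : c lo <= j < c hi -> pc (x j) + gap neg n d j <= pc (x j.+1).
  move=> jr; have lt : x j < x j.+1 by apply: pos_lt => //; rewrite -/c; lia.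
  have -> : x j.+1 = x j + (x j.+1 - x j) by lia.
  rewrite /pc iotaD count_cat leq_add2l add1n.
  have -> : x j.+1 - x j = x j.+1 - (x j).+1 + 1 by lia.
  rewrite iotaD count_cat; apply: leq_trans (leq_addr _ _).
  have xlo : lo <= x j.
    rewrite -ilo; have [->//|ne] := eqVneq j (c lo).
    by apply/ltnW/pos_lt; rewrite -/c; lia.
  have xhi : x j.+1 <= hi.
    rewrite -ihi; have [->//|ne] := eqVneq j.+1 (c hi).
    by apply/ltnW/pos_lt; rewrite -/c; lia.
  apply: leq_trans (@count_hits d A (x j) (x j.+1 - (x j).+1) _) _ => [y y1 y2|].
    apply: chain_next => //; apply/hasP.
      by exists lo => //=; lia.
    by exists hi => //=; lia.
  rewrite leq_eqVlt; apply/orP; left; apply/eqP/eq_in_count => z.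
  rewrite mem_iota => zr; rewrite (@between_notneg _ n j) ?andbT // -/x; lia.
have tele t : t <= Q -> pc lo + \sum_(c lo <= j < c lo + t) gap neg n d j <= pc (x (c lo + t)).
  elim: t => [|t IH] tQ; first by rewrite addn0 big_geq // addn0 ilo.
  rewrite addnS big_nat_recr /=; last by lia.
  by have := IH (ltnW tQ); have := @pc_step (c lo + t) ltac:(lia); lia.
have pcn : pc (x (c lo + Q)) <= count (predC neg) A.
  rewrite /pc -!size_filter; apply: uniq_leq_size; first by rewrite filter_uniq ?iota_uniq.
  by move=> z; rewrite !mem_filter /= => /andP[/andP[-> ->]].
apply: leq_trans pcn; apply: leq_trans (tele Q (leqnn _)).
apply: leq_trans (leq_addl _ _); apply: spr; last by rewrite -/c; lia.
have := cntS neg lo.-1; rewrite prednK ?nlo; last by lia.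
by rewrite -/c; lia.
Qed.

(** When the marks are the values -1 and [k = (Q.+1).*2], a block with half its points marked is a
    zero-sum block. *)
Definition balanced_free Q := forall A : seq nat,
  sorted (fun x y => x < y <= x + d) A -> all (fun x => 1 <= x <= n) A ->
  size A = (Q.+1).*2 -> count neg A <> Q.+1.

Lemma balanced_free_gap_sum Q i : balanced_free Q -> 0 < i -> i + Q <= c n ->
  (Q.+1).*2 <= x (i + Q) - x i + 1 -> Q.+1 < \sum_(i <= j < i + Q) gap neg n d j.
Proof.
move=> bf i0 iQ long; rewrite ltnNge; apply/negP => small.
set lo := x i in long *; set hi := x (i + Q) in long *.
have lo0 : 0 < lo by rewrite /lo -[0](pos0 neg n); apply: pos_lt.
have hin : hi <= n by apply: pos_le.
have clo : c lo = i by apply: cntK; rewrite -/c; lia.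
have chi : c hi = i + Q by apply: cntK.
(* The marked points together with the multiples of d counted from the last marked
   point form a chain with few unmarked points; adding an initial segment [.., z[
   and letting z grow makes its size pass through 2(Q+1). *)
pose base y := d %| y - x (c y).
have base_pos j : j <= c n -> base (x j).
  by move=> jn; rewrite /base /c cntK // subnn dvdn0.
have base_neg y : lo <= y <= hi -> neg y -> base y.
  by move=> yr ny; rewrite /base /x /c pos_neg ?subnn ?dvdn0 //; lia.
have cover z y : lo <= y < lo + (hi - lo) ->
    exists2 w, base w || (w < z) & (y < w <= y + d) && (w <= lo + (hi - lo)).
  move=> yr; have yn : y <= n by lia.
  have cyn : c y <= c n by apply: cnt_mono.
  have xy : x (c y) <= y by rewrite pos_galois.
  have yx : y < x (c y).+1 by rewrite ltnNge pos_galois // -ltnNge.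
  have xhi : x (c y).+1 <= hi.
    by rewrite /x pos_galois // -/c chi ltnNge -(pos_galois neg _ yn) -ltnNge -/x -/hi; lia.
  (* The first multiple of [d] beyond [y], counted from the preceding mark; if it reaches the next
     mark, that mark is taken instead. *)
  pose w := x (c y) + ((y - x (c y)) %/ d).+1 * d.
  have yw : y < w <= y + d.
    have := divn_eq (y - x (c y)) d; have := ltn_mod (y - x (c y)) d.
    by rewrite d_gt0 /w mulSn; lia.
  have [wx|xw] := ltnP w (x (c y).+1).
    exists w; last by lia.
    rewrite /base /c (@cnt_between neg n (c y)) -/x -/c; [|lia|lia].
    by rewrite /w addKn dvdn_mull.
  exists (x (c y).+1); last by lia.
  rewrite base_pos // ltn_neqAle cyn andbT; apply/eqP=> e.
  by move: xhi; rewrite e /x /c pos_last; lia.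
pose A z := [seq y <- iota lo (hi - lo).+1 | base y || (y < z)].
have negA z : count neg (A z) = Q.+1.
  rewrite count_filter (eq_in_count (a2 := neg)) => [|y]; last first.
    rewrite mem_iota => yr /=; case ny: (neg y) => //=.
    by rewrite base_neg //; lia.
  have -> : lo = lo.-1.+1 by lia.
  rewrite cnt_iota -/c; have -> : lo.-1 + (hi - lo.-1.+1).+1 = hi by lia.
  have := cntS neg lo.-1; rewrite prednK // neg_pos // -?/c; last by lia.
  by rewrite clo chi; lia.
have base_gap j : j < c n -> count base (iota (x j).+1 (x j.+1 - x j)) = (gap neg n d j).+1.
  move=> jn; have lt : x j < x j.+1 by apply: pos_lt => //; exact: ltnW.
  have -> : x j.+1 - x j = x j.+1 - (x j).+1 + 1 by lia.
  rewrite iotaD count_cat /= addn0 -(addn1 (gap _ _ _ _)); congr (_ + _).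
    rewrite /gap -(count_dvdn_iota d (x j)); apply: eq_in_count => y; rewrite mem_iota => yr.
    rewrite /base /c (@cnt_between neg n j) -/x //; first by lia.
    by have := pos_leSn neg n j.+1; rewrite -/x; lia.
  rewrite subnKC // base_pos //.
have base_sum t : t <= Q ->
    count base (iota lo.+1 (x (i + t) - lo)) = t + \sum_(i <= j < i + t) gap neg n d j.
  elim: t => [|t IH] tQ; first by rewrite addn0 big_geq // subnn.
  rewrite addnS big_nat_recr /=; last by lia.
  have lt : x (i + t) < x (i + t).+1 by apply: pos_lt => //; rewrite -/c; lia.
  have le : lo <= x (i + t).
    by have := @pos_stretch neg n (i + t) i; rewrite -/x -/c -/lo; lia.
  have -> : x (i + t).+1 - lo = x (i + t) - lo + (x (i + t).+1 - x (i + t)) by lia.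
  rewrite iotaD count_cat IH; last by lia.
  have -> : lo.+1 + (x (i + t) - lo) = (x (i + t)).+1 by lia.
  by rewrite base_gap; lia.
have A_ne z : z <= hi.+1 -> size (A z) <> (Q.+1).*2.
  move=> zh sz; apply: (bf (A z)) => //.
    by apply: chain_filter_iota => y yr; apply: cover.
  by apply/allP => y; rewrite mem_filter mem_iota => yr; lia.
have slow z : z < hi.+1 -> size (A z.+1) <= (size (A z)).+1 /\ size (A z) <= (size (A z.+1)).+1.
  move=> _; rewrite !size_filter.
  by have := @count_lt_succ base z (iota lo (hi - lo).+1) (iota_uniq _ _); lia.
(* At [z = 0] the size is [Q.+1] plus the window sum, at most [(Q.+1).*2] by [small]; at [z = hi.+1]
   it is that of the whole span, at least [(Q.+1).*2] by [long]. *)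
have := A_ne _ (leqnn _); have := slow_avoiding_const slow A_ne (leqnn _).
have -> : size (A 0) = Q.+1 + \sum_(i <= j < i + Q) gap neg n d j.
  rewrite size_filter (eq_count (a2 := base)) => [|y]; last by rewrite ltn0 orbF.
  rewrite /= base_pos; last by rewrite -/c; lia.
  by rewrite base_sum // addSn.
have -> : size (A hi.+1) = (hi - lo).+1.
  rewrite size_filter (eq_in_count (a2 := predT)) ?count_predT ?size_iota // => y.
  by rewrite mem_iota => yr /=; apply/orP; right; lia.
move=> + ne; have long' : (Q.+1).*2 < (hi - lo).+1 by lia.
by rewrite long'; lia.
Qed.

(** An interval is a block, and a shift by one changes its number of marks by at most 1, so this
    number stays on one side of [Q.+1]. *)
Lemma intervals_avoid Q : balanced_free Q ->
  forall w, w + (Q.+1).*2 <= n ->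
    (Q.+1 < c (w + (Q.+1).*2) - c w) = (Q.+1 < c ((Q.+1).*2)).
Proof.
move=> bf w wn.
pose g w := c (w + (Q.+1).*2) - c w.
have -> : c ((Q.+1).*2) = g 0 by rewrite /g add0n subn0.
apply: (@slow_avoiding_const g (n - (Q.+1).*2)); last by lia.
  move=> u _; rewrite /g /c addSn !cntS.
  have := @cnt_mono neg u (u + (Q.+1).*2) (leq_addr _ _).
  by do 2!case: (neg _); lia.
move=> u un; rewrite /g /c -cnt_iota; apply: bf; rewrite ?size_iota //.
  have := @chain_filter_iota d predT u.+1 (Q.*2.+1).
  rewrite filter_predT; apply=> y yr; exists y.+1 => //; lia.
by apply/allP => y; rewrite mem_iota; lia.
Qed.

Lemma balanced_free_spread Q : balanced_free Q ->
  2 * (Q.+1).*2 <= n -> 3 * c n <= n -> spread neg n d Q.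
Proof.
move=> bf n_large few i i0; rewrite -/c => iQ.
have [long|short] := leqP (Q.+1).*2 (x (i + Q) - x i + 1).
  exact: balanced_free_gap_sum.
exfalso; set lo := x i in short; set hi := x (i + Q) in short.
have lo0 : 0 < lo by rewrite /lo -[0](pos0 neg n); apply: pos_lt.
have hin : hi <= n by apply: pos_le.
have clo : c lo = i by apply: cntK; rewrite -/c; lia.
have chi : c hi = i + Q by apply: cntK.
have clo' : c lo.-1 < i.
  have := cntS neg lo.-1; rewrite prednK // neg_pos // -/c; last by lia.
  by rewrite clo; lia.
have lohi : lo <= hi by have := @pos_stretch neg n (i + Q) i; rewrite -/x -/c -/lo -/hi; lia.
(* The q marked points fit in an interval of length k, so no interval of length k
   has few marked points, and then there are too many of them in total. *)
pose w := minn lo.-1 (n - (Q.+1).*2).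
have wn : w + (Q.+1).*2 <= n by rewrite /w; lia.
have cw : c w < i by apply: leq_ltn_trans (cnt_mono _ _) clo'; rewrite /w; lia.
have cw' : i + Q <= c (w + (Q.+1).*2).
  by rewrite -chi; apply: cnt_mono; rewrite /w; lia.
have many u : u + (Q.+1).*2 <= n -> Q.+1 < c (u + (Q.+1).*2) - c u.
  move=> un; rewrite intervals_avoid // -(intervals_avoid bf wn) ltn_neqAle.
  apply/andP; split; last by lia.
  apply/eqP => e; apply: (bf (iota w.+1 (Q.+1).*2)); rewrite ?size_iota ?cnt_iota -/c //.
    have := @chain_filter_iota d predT w.+1 (Q.*2.+1).
    rewrite filter_predT; apply=> y yr; exists y.+1 => //; lia.
  by apply/allP => y; rewrite mem_iota; lia.
have grow t : t * (Q.+1).*2 <= n -> t * Q.+2 <= c (t * (Q.+1).*2).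
  elim: t => [//|t IH] tn.
  have := IH ltac:(lia); have := many (t * (Q.+1).*2) ltac:(lia).
  have := @cnt_mono neg _ _ (leq_addr (Q.+1).*2 (t * (Q.+1).*2)).
  by rewrite !mulSn (addnC (Q.+1).*2) -/c; lia.
(* With [t] full intervals, [3 * t * (Q + 2) <= n < 2 * (t + 1) * (Q + 1)], whereas [t >= 2] gives
   [3 * t >= 2 * (t + 1)]. *)
have := divn_eq n (Q.+1).*2; have := ltn_mod n (Q.+1).*2.
have : 2 <= n %/ (Q.+1).*2 by rewrite leq_divRL.
set t := n %/ _; set e := n %% _ => t2 eb nE.
have := grow t ltac:(lia); have := @cnt_mono neg (t * (Q.+1).*2) n ltac:(lia).
by rewrite -/c; nia.
Qed.

End Blocks.

(** * Location of the marked points *)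

Section Runs.
Local Open Scope nat_scope.

Lemma sorted_block_iota (S : seq nat) : sorted ltn S -> is_block S ->
  exists z, S = iota z (size S).
Proof.
case: S => [|z S]; first by exists 0.
move=> sS bS; exists z.
have {bS}bS : forall y, z <= y <= last z S -> y \in z :: S.
  by move=> y; apply: bS; rewrite ?mem_head ?mem_last.
rewrite /=; congr (_ :: _); elim: S z sS bS => [//|y S IH] z /= /andP[zy sS] bS.
have yE : y = z.+1.
  have : z.+1 \in [:: z, y & S].
    apply: bS; rewrite leqnSn /= (leq_trans zy) //.
    have := mem_last y S; rewrite inE => /orP[/eqP->//|].
    by move/(allP (order_path_min ltn_trans sS))/ltnW.
  rewrite !inE => /or3P[/eqP|/eqP//|]; first by lia.
  by move/(allP (order_path_min ltn_trans sS)) => /= ?; lia.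
subst y; congr (_ :: _); apply: IH => // w wr.
have := bS w; rewrite !inE => /(_ ltac:(lia)) /orP[/eqP|]; [lia | by []].
Qed.

Lemma block_iota z l : is_block (iota z l).
Proof. by move=> a y e; rewrite !mem_iota; lia. Qed.

Lemma sum_pick (F : nat -> nat) w l J v : w <= J < w + l ->
  v < \sum_(w <= j < w + l) F j -> F J <= v ->
  exists j, [/\ w <= j < w + l, j != J & 0 < F j].
Proof.
move=> Jw big FJ.
case: (boolP (has (fun j => (j != J) && (0 < F j)) (index_iota w (w + l)))).
  by case/hasP => j; rewrite mem_index_iota => ? /andP[]; exists j.
move=> /hasPn none; move: big; rewrite (bigD1_seq J) ?mem_index_iota ?iota_uniq //=.
rewrite big_seq_cond big1 ?addn0 => [|j /andP[/none + jJ]]; first by lia.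
by rewrite jJ /= lt0n negbK => /eqP.
Qed.

Lemma sum_two (F : nat -> nat) w l J j : w <= J < w + l -> w <= j < w + l ->
  j != J -> F J + F j <= \sum_(w <= i < w + l) F i.
Proof.
move=> Jw jw jJ.
rewrite (bigD1_seq J) ?mem_index_iota ?iota_uniq //= leq_add2l.
rewrite -big_filter (bigD1_seq j) ?filter_uniq ?iota_uniq //= ?leq_addr //.
by rewrite mem_filter jJ mem_index_iota.
Qed.

End Runs.

(** * The decomposition of [n] forced by the window condition *)

Section Structure.
Local Open Scope nat_scope.
Variables (neg : pred nat) (d m s : nat).
Hypotheses (d_gt0 : 0 < d) (m_gt0 : 0 < m).

(** With [k = (Q.+1).*2], these agree with [b_] and [r_], and [n] consists of R_1, T_1, ..., T_m,
    R_(m+1) in this order. *)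
Let Q := m.*2 + s.
Let b := Q + d * Q.+2.
Let r := Q + d * s.
Let n := m * b + r.
Hypotheses (s_le1 : s <= 1) (cnt_n : cnt neg n = m.+1 * Q).

Let c := cnt neg.
Let x := pos neg n.

(* The marks are exactly Q in each R_i and none in T_i; here and below the index
   i is that of the paper minus one. *)
Definition layout := forall i, i <= m -> c (i * b) = i * Q /\ c (i * b + r) = i.+1 * Q.

Lemma Q_gt1 : 1 < Q. Proof. by rewrite /Q; lia. Qed.

Lemma b_r : b - r = d * (Q.+2 - s).
Proof. by rewrite /b /r subnDl -mulnBr. Qed.

Lemma r_le_b : r <= b.
Proof. by rewrite /b /r leq_add2l leq_mul2l; have := s_le1; lia. Qed.

(** Each step to the next mark is at least 1 plus [d] times its gap, so [Q] steps advance by at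
    least [Q + d * (Q + 2) = b]. *)
Lemma spread_shift j : spread neg n d Q -> 0 < j -> j + Q <= c n -> x j + b <= x (j + Q).
Proof.
move=> spr j0 jQ.
have tele t : j + t <= c n -> x j + t + d * \sum_(j <= i < j + t) gap neg n d i <= x (j + t).
  elim: t => [|t IH] tn; first by rewrite !addn0 big_geq // muln0 addn0.
  rewrite !addnS big_nat_recr /=; last by lia.
  have := IH ltac:(lia).
  have lt : x (j + t) < x (j + t).+1 by apply: pos_lt => //; rewrite -/c; lia.
  have := leq_trunc_div (x (j + t).+1 - (x (j + t)).+1) d.
  by rewrite mulnC -/(gap neg n d (j + t)) mulnDr; lia.
have := tele Q jQ; have := spr j j0 jQ.
by move/(leq_mul (leqnn d)); rewrite /b; lia.
Qed.

(** Shifts from the left end give [c (i * b) <= i * Q], shifts from the right end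
    [i.+1 * Q <= c (i * b + r)]; monotonicity of [c] forces equality in both. *)
Lemma spread_layout : spread neg n d Q -> layout.
Proof.
move=> spr; have Q1 := Q_gt1; have rb := r_le_b.
have lower t : t <= m -> t * b < x (t * Q).+1.
  elim: t => [|t IH] tm.
    by rewrite !mul0n -[X in X < _](pos0 neg n); apply: pos_lt.
  have bound : (t * Q).+1 + Q <= c n.
    by rewrite /c cnt_n addSn addnC -mulSn; have := leq_mul2r Q t.+2 m.+1; rewrite mulSn; lia.
  have := IH (ltnW tm); have := spread_shift spr (ltn0Sn _) bound.
  by rewrite addSn !mulSnr; lia.
have upper u : u <= m -> x ((m.+1 - u) * Q) <= (m - u) * b + r.
  elim: u => [|u IH] um; first by rewrite !subn0 -/n -cnt_n; apply: pos_le.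
  have := IH (ltnW um).
  have -> : m.+1 - u = (m.+1 - u.+1).+1 by lia.
  have -> : m - u = (m - u.+1).+1 by lia.
  have bound : (m.+1 - u.+1) * Q + Q <= c n.
    by rewrite /c cnt_n -mulSnr leq_mul2r; lia.
  have := spread_shift spr _ bound; rewrite muln_gt0 !mulSnr; lia.
have upper' i : i <= m -> i.+1 * Q <= c (i * b + r).
  move=> im; rewrite -(@pos_galois _ n); last by rewrite /n leq_add2r leq_mul2r im orbT.
  have := upper (m - i) (leq_subr _ _).
  have -> : m.+1 - (m - i) = i.+1 by lia.
  by rewrite subKn.
have at_b i : i <= m -> c (i * b) = i * Q.
  move=> im; have ibn : i * b <= n.
    by rewrite /n (leq_trans _ (leq_addr _ _)) // leq_mul2r im orbT.
  apply/eqP; rewrite eqn_leq -ltnS ltnNge -(pos_galois _ _ ibn) -ltnNge lower //=.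
  case: i im ibn => [//|i] im ibn.
  apply: leq_trans (upper' i (ltnW im)) (cnt_mono _ _); rewrite mulSnr; lia.
move=> i im; split; first exact: at_b.
apply/eqP; rewrite eqn_leq upper' // andbT.
have [->|ne] := eqVneq i m; first by rewrite -/n /c cnt_n.
rewrite -at_b ?ltn_neqAle ?ne //; apply: cnt_mono; rewrite mulSnr; lia.
Qed.

Section Layout.
Hypothesis lay : layout.

Definition R_pluses i := [seq y <- iota (i * b).+1 r | ~~ neg y].

Lemma size_R_pluses i : i <= m -> size (R_pluses i) = d * s.
Proof.
move=> im; have [cb cr] := lay im.
have := count_predC neg (iota (i * b).+1 r).
rewrite size_iota cnt_iota -/c cb cr size_filter /r.
have -> : count (fun y => ~~ neg y) (iota (i * b).+1 (Q + d * s))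
  = count (predC neg) (iota (i * b).+1 (Q + d * s)) by [].
by rewrite mulSn; lia.
Qed.

Lemma sorted_R_pluses i : sorted ltn (R_pluses i).
Proof. by apply: sorted_filter; [exact: ltn_trans | exact: iota_ltn_sorted]. Qed.

Lemma end_le_n i : i <= m -> i * b + r <= n.
Proof. by move=> im; rewrite leq_add2r leq_mul2r im orbT. Qed.

Lemma pos_in_R i j : i <= m -> i * Q < j <= i.+1 * Q -> i * b < x j <= i * b + r.
Proof.
move=> im /andP[j1 j2]; have [cb cr] := lay im; have en := end_le_n im.
rewrite ltnNge !pos_galois -/c ?cb ?cr //; last by lia.
by rewrite -ltnNge j1 j2.
Qed.

Lemma pos_next i : i < m -> i.+1 * b < x (i.+1 * Q).+1.
Proof.
move=> im; have [cb cr] := lay im; have := end_le_n im => en.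
by rewrite ltnNge pos_galois -/c ?cb ?ltnn //; lia.
Qed.

(** This gap contains a whole T, which has [d * (Q.+2 - s)] points. *)
Lemma gap_middle i : i < m -> Q.+2 - s <= gap neg n d (i.+1 * Q).
Proof.
move=> im; rewrite /gap leq_divRL // mulnC -b_r.
have Q1 := Q_gt1; have rb := r_le_b.
have Jr : i * Q < i.+1 * Q <= i.+1 * Q by rewrite leqnn andbT ltn_mul2r; lia.
by have := pos_next im; have := pos_in_R (ltnW im) Jr; rewrite -/x [i.+1 * b]mulSn; lia.
Qed.

(** Among [Q] consecutive indices one is a multiple of [Q]. *)
Lemma window_middle w : 0 < w -> w + Q <= c n ->
  exists2 i, i < m & w <= i.+1 * Q < w + Q.
Proof.
move=> w0; rewrite /c cnt_n => wn; have Q1 := Q_gt1.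
exists (w.-1 %/ Q); first by rewrite ltn_divLR //; move: wn; rewrite mulSn; lia.
by have := divn_eq w.-1 Q; have := ltn_mod w.-1 Q; rewrite mulSn; lia.
Qed.

Lemma layout_spread0 : s = 0 -> spread neg n d Q.
Proof.
move=> s0 w w0 wn; have [i im Jw] := window_middle w0 wn.
have := gap_middle im; rewrite {1}s0 subn0 => /leq_trans; apply.
by rewrite (bigD1_seq (i.+1 * Q)) ?mem_index_iota ?iota_uniq //= leq_addr.
Qed.

(** * The case s = 1: runs of d unmarked points *)

Hypothesis s1 : s = 1.

(** Each R has just [d] unmarked points, so an unmarked run of length [d] in it uses them all. *)
Lemma R_pluses_run i z : i <= m -> i * b < z -> z + d <= (i * b + r).+1 ->
  (forall y, z <= y < z + d -> ~~ neg y) -> R_pluses i = iota z d.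
Proof.
move=> im zl zr zn.
apply: (irr_sorted_eq ltn_trans ltnn); [exact: sorted_R_pluses | exact: iota_ltn_sorted |].
have sub : {subset iota z d <= R_pluses i}.
  move=> y; rewrite mem_iota mem_filter mem_iota => yz; rewrite zn //=; lia.
have sz : size (R_pluses i) <= size (iota z d) by rewrite size_R_pluses // s1 size_iota muln1.
by have [_ H] := uniq_min_size (iota_uniq z d) sub sz; move=> y; rewrite H.
Qed.

Lemma gap_run i j : i <= m -> i * Q < j < i.+1 * Q -> 0 < gap neg n d j ->
  R_pluses i = iota (x j).+1 d.
Proof.
move=> im jr; rewrite /gap divn_gt0 // => big.
have := @pos_in_R i j im ltac:(lia); have := @pos_in_R i j.+1 im ltac:(lia).
move=> Hj1 Hj; rewrite -/x in big.
apply: R_pluses_run => //; [lia | lia | move=> y yr].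
by apply: (@between_notneg _ n j); rewrite -/x; lia.
Qed.

(** Every window through the middle gap then needs a second positive gap, and the R on either side
    offers only one. *)
Lemma spread_small_gap i : spread neg n d Q -> i < m ->
  gap neg n d (i.+1 * Q) <= Q.+1 ->
  exists j0 j1, [/\ i * Q < j0 < i.+1 * Q, i.+1 * Q < j1 < i.+2 * Q,
    R_pluses i = iota (x j0).+1 d, R_pluses i.+1 = iota (x j1).+1 d & j1 <= j0 + Q].
Proof.
move=> spr im small; set J := i.+1 * Q; have Q1 := Q_gt1.
have J1 : J = i * Q + Q by rewrite /J mulSnr.
have J2 : i.+2 * Q = J + Q by rewrite mulSnr.
have Jn : J + Q <= c n by rewrite -J2 /c cnt_n leq_mul2r; lia.
have pick w : 0 < w -> w <= J < w + Q ->
    exists j, [/\ w <= j < w + Q, j != J & 0 < gap neg n d j].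
  by move=> w0 wJ; apply: (sum_pick wJ) small; apply: spr => //; rewrite -/c; lia.
have [j0 [j0r j0J j0g]] := pick (i * Q).+1 ltac:(lia) ltac:(lia).
have [j1 [j1r j1J j1g]] := pick J ltac:(lia) ltac:(lia).
have run0 j : i * Q < j < J -> 0 < gap neg n d j -> R_pluses i = iota (x j).+1 d.
  by apply: gap_run; lia.
have run1 j : J < j < J + Q -> 0 < gap neg n d j -> R_pluses i.+1 = iota (x j).+1 d.
  by rewrite -J2; apply: gap_run.
have inj j j' : j <= c n -> j' <= c n -> iota (x j).+1 d = iota (x j').+1 d -> j = j'.
  move=> jn j'n; have [e ->] : exists e, d = e.+1 by exists d.-1; lia.
  by case=> /(pos_inj jn j'n).
have r0 := run0 j0 ltac:(lia) j0g; have r1 := run1 j1 ltac:(lia) j1g.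
exists j0, j1; rewrite J2; split; rewrite -/J //; [lia | lia |].
rewrite leqNgt; apply/negP=> far.
(* This window contains [J], but starts after [j0] and ends before [j1]. *)
have [j [jr jJ jg]] := pick j0.+1 ltac:(lia) ltac:(lia).
have [lt|ge] := ltnP j J.
  have rj := run0 j ltac:(lia) jg.
  by have := @inj j j0 ltac:(lia) ltac:(lia) _; rewrite -rj -r0 => /(_ erefl); lia.
have rj := run1 j ltac:(lia) jg.
by have := @inj j j1 ltac:(lia) ltac:(lia) _; rewrite -rj -r1 => /(_ erefl); lia.
Qed.

Definition between i := [seq y <- iota 1 n | neg y &&
  all (fun z => z < y) (R_pluses i) && all (fun z => y < z) (R_pluses i.+1)].

(** Length of the maximal unmarked stretch around a T; subtracting [b - r] leaves its points outside
    T. *)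
Definition middle_run i := x (i.+1 * Q).+1 - (x (i.+1 * Q)).+1.

(** The last two clauses of [F2] in terms of marks, the maximal block being the stretch between two
    consecutive marks. *)
Definition run_conditions := forall i, i < m ->
  (~ is_block (R_pluses i) -> d <= middle_run i - (b - r)) /\
  (is_block (R_pluses i) ->
   (forall y, y \in iota (i * b).+1 r -> ~~ (x (i.+1 * Q) < y < x (i.+1 * Q).+1)) ->
   is_block (R_pluses i.+1) /\ size (between i) <= Q).

Lemma R_pluses_block i : i <= m -> is_block (R_pluses i) ->
  exists z, R_pluses i = iota z d.
Proof.
move=> im /(sorted_block_iota (sorted_R_pluses i))[z].
by rewrite size_R_pluses // s1 muln1; exists z.
Qed.

Lemma R_pluses_bounds i z : R_pluses i = iota z d ->
  [/\ i * b < z, z + d <= (i * b + r).+1 & forall y, z <= y < z + d -> ~~ neg y].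
Proof.
move=> E.
have mem y : z <= y < z + d -> ~~ neg y /\ i * b < y <= i * b + r.
  by rewrite -mem_iota -E mem_filter mem_iota => /andP[-> H]; split=> //; lia.
split; last by move=> y /mem[].
  by have [_] := mem z ltac:(lia); lia.
by have [_] := mem (z + d.-1) ltac:(lia); lia.
Qed.

Lemma size_between i z z' : i < m ->
  R_pluses i = iota z d -> R_pluses i.+1 = iota z' d ->
  size (between i) = c z' - c z.
Proof.
move=> im E E'; have [zl zr zn] := R_pluses_bounds E.
have [zl' zr' zn'] := R_pluses_bounds E'.
have rb := r_le_b; have en := end_le_n im.
rewrite mulSn in zl' zr' en.
have cz : c (z + d.-1) = c z by apply: notneg_cnt => y yr; apply: zn; lia.
have cz' : c z'.-1 = c z'.
  have := cntS neg z'.-1; rewrite prednK; last by lia.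
  by rewrite (negbTE (zn' _ _)) ?addn0 //; lia.
(* Cut [n] after the last point [e] of the first run and before the first point [z'] of the second;
   only the middle part contributes. *)
rewrite size_filter -cz -cz'; have [e eE] : exists e, e = z + d.-1 by eexists.
rewrite -eE; have -> : n = e + (z'.-1 - e) + (n - z'.-1) by lia.
rewrite !iotaD !count_cat !add1n.
have -> : e + (z'.-1 - e) = z'.-1 by lia.
rewrite (eq_in_count (a2 := pred0)) ?count_pred0 => [|y]; last first.
  rewrite mem_iota E => yr; apply/negbTE; rewrite !negb_and orbC orbA; apply/orP; right.
  by apply/allPn; exists e; rewrite ?mem_iota /=; lia.
rewrite (eq_in_count (a2 := neg)) => [|y]; last first.
  rewrite mem_iota E E' => yr; case: (neg y) => //=.
  by apply/andP; split; apply/allP => w; rewrite mem_iota /=; lia.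
rewrite (cnt_iota neg) -/c [X in _ + X](eq_in_count (a2 := pred0)) ?count_pred0 => [|y]; last first.
  rewrite mem_iota E' => yr; apply/negbTE; rewrite negb_and; apply/orP; right.
  by apply/allPn; exists z'; rewrite ?mem_iota /=; lia.
by rewrite addn0 add0n; congr (c _ - _); lia.
Qed.

(** If the middle gap is at most [Q.+1], both neighbouring R contain a full run, with at most [Q]
    marks in between. Otherwise the stretch exceeds T by at least [d]. *)
Lemma spread_run_conditions : spread neg n d Q -> run_conditions.
Proof.
move=> spr i im; have Q1 := Q_gt1; have rb := r_le_b.
have brE : b - r = d * Q.+1 by rewrite b_r s1 subn1.
have [small|large] := leqP (gap neg n d (i.+1 * Q)) Q.+1.
  have [j0 [j1 [j0r j1r r0 r1 close]]] := spread_small_gap spr im small.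
  split; first by rewrite r0; case; exact: block_iota.
  rewrite (size_between im r0 r1) r1 => _ _; split; first exact: block_iota.
  have [zl zr zn] := R_pluses_bounds r0; have [zl' zr' zn'] := R_pluses_bounds r1.
  have cK j : j <= cnt neg n -> ~~ neg (x j).+1 -> c (x j).+1 = j.
    by move=> jn nn; rewrite /c cntS (negbTE nn) cntK // addn0.
  have j1n : j1 <= cnt neg n.
    by rewrite cnt_n (leq_trans (ltnW (proj2 (andP j1r)))) // leq_mul2r; lia.
  have -> : c (x j0).+1 = j0 by apply: cK; [lia | apply: zn; lia].
  have -> : c (x j1).+1 = j1 by apply: cK; [lia | apply: zn'; lia].
  by lia.
have mid : d * Q.+2 <= middle_run i.
  by move: large; rewrite /gap leq_divRL // mulnC.
have mid' : d <= middle_run i - (b - r) by rewrite brE; move: mid; rewrite !mulnS; lia.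
split=> // blk off.
have [z Ez] := R_pluses_block (ltnW im) blk.
have [zl zr zn] := R_pluses_bounds Ez.
have Jr : i * Q < i.+1 * Q <= i.+1 * Q by rewrite leqnn andbT ltn_mul2r; lia.
have Jp := pos_in_R (ltnW im) Jr; have Jn := pos_next im.
rewrite -/x in Jp Jn.
(* By [off] the left R ends with a mark, so the surplus of [d] points fills the beginning of the
   right R. *)
have Je : x (i.+1 * Q) = i * b + r.
  have := off (i * b + r); rewrite mem_iota; move: Jn; rewrite mulSn; lia.
have E' : R_pluses i.+1 = iota (i.+1 * b).+1 d.
  apply: R_pluses_run => // [|y yr].
    by rewrite addSn ltnS leq_add2l /r s1 muln1 leq_addl.
  apply: (@between_notneg _ n (i.+1 * Q)); rewrite -/x.
  by have := mulSn i b; move: mid'; rewrite /middle_run; lia.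
rewrite (size_between im Ez E') E'; split; first exact: block_iota.
have [_ _ zn'] := R_pluses_bounds E'.
have -> : c (i.+1 * b).+1 = c (i.+1 * b).
  by rewrite /c cntS (negbTE (zn' _ _)) ?addn0 //; lia.
(* The marks between the runs are thus among the [Q] marks of the left R. *)
have [-> _] := lay im; have [cb _] := lay (ltnW im).
have := @cnt_mono neg (i * b) z ltac:(lia); rewrite -/c cb [_.+1 * Q]mulSn; lia.
Qed.

(** A deficient window has middle gap exactly [Q.+1] and all other gaps 0. The conditions then yield
    a full run on each side, and the window must contain the gap of one of them. *)
Lemma run_conditions_spread : run_conditions -> spread neg n d Q.
Proof.
move=> cond w w0 wn; have Q1 := Q_gt1; have rb := r_le_b.
have brE : b - r = d * Q.+1 by rewrite b_r s1 subn1.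
have [i im Jw] := window_middle w0 wn; set J := i.+1 * Q in Jw.
have [nonblk blk] := cond i im.
have gJ : Q.+1 <= gap neg n d J by have := gap_middle im; rewrite {1}s1 subSS subn0.
rewrite ltnNge; apply/negP => small.
have gJ' : gap neg n d J <= Q.+1.
  apply: leq_trans small.
  by rewrite (bigD1_seq J) ?mem_index_iota ?iota_uniq //= leq_addr.
have mid : middle_run i < d * Q.+2 by rewrite mulnC -ltn_divLR // ltnS.
have mid' : middle_run i - (b - r) < d by rewrite brE; move: mid; rewrite !mulnS; lia.
have other j : w <= j < w + Q -> j != J -> d <= x j.+1 - (x j).+1 -> False.
  move=> jw jJ dj; have := sum_two (gap neg n d) Jw jw jJ.
  have : 0 < gap neg n d j by rewrite /gap divn_gt0.
  by lia.
(* The goal is [False], so the double negation suffices. *)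
have notnot : ~ ~ is_block (R_pluses i) by move=> /nonblk; lia.
apply: notnot => isb.
have [z Ez] := R_pluses_block (ltnW im) isb.
have [zl zr zn] := R_pluses_bounds Ez.
have Jr : i * Q < J <= i.+1 * Q by rewrite leqnn andbT ltn_mul2r; lia.
have Jp := pos_in_R (ltnW im) Jr; have Jn := pos_next im.
have Jcn : J <= c n by rewrite /c cnt_n leq_mul2r; lia.
rewrite -/x in Jp; rewrite -/x -/J mulSn in Jn.
have Jneg : neg (x J) by apply: neg_pos => //; lia.
(* Such a [y] would bring the whole run from [z] into the stretch, hence [d] points outside T,
   against [mid']. *)
have off y : y \in iota (i * b).+1 r -> ~~ (x J < y < x J.+1).
  rewrite mem_iota => yr; apply/negP => yJ.
  have yz : z <= y < z + d.
    rewrite -mem_iota -Ez mem_filter mem_iota yr andbT.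
    exact: between_notneg yJ.
  have Jz : x J < z.
    by rewrite ltnNge; apply/negP => zJ; have := zn (x J); rewrite Jneg => /(_ ltac:(lia)).
  by move: mid'; rewrite /middle_run -/J; lia.
have [isb' few] := blk isb off.
have [z' Ez'] := R_pluses_block im isb'.
have [zl' zr' zn'] := R_pluses_bounds Ez'.
rewrite (size_between im Ez Ez') in few.
have en := end_le_n im.
have run_gap u : 0 < u -> u + d <= n.+1 -> (forall y, u <= y < u + d -> ~~ neg y) ->
    d <= x (c u).+1 - (x (c u)).+1 /\ x (c u) < u.
  move=> u0 ud un; have un' : u <= n by lia.
  have cu : c (u + d.-1) = c u by apply: notneg_cnt => y yr; apply: un; lia.
  have lo : x (c u) < u.
    have : x (c u) <= u by rewrite /x pos_galois.
    rewrite leq_eqVlt => /orP[/eqP e|//].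
    have := un u ltac:(lia); rewrite -{1}e neg_pos //; last exact: cnt_mono.
    by rewrite lt0n; apply/negP => /eqP c0; move: e; rewrite c0 /x pos0; lia.
  have hi : u + d.-1 < x (c u).+1.
    by rewrite ltnNge /x pos_galois -/c ?cu ?ltnn //; lia.
  by split=> //; lia.
have [g0 lt0] := run_gap z ltac:(lia) ltac:(move: en; rewrite mulSn; lia) zn.
have [g1 lt1] := run_gap z' ltac:(lia) ltac:(lia) zn'.
have [cb cr] := lay (ltnW im); have [cb' cr'] := lay im.
have c0r : i * Q <= c z <= J.
  by rewrite /J -cb -cr; apply/andP; split; apply: cnt_mono; lia.
have c1r : J <= c z' <= J + Q.
  have -> : J + Q = i.+2 * Q by rewrite mulSnr.
  rewrite /J -cb' -cr'.
  by apply/andP; split; apply: cnt_mono; lia.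
have c0J : c z != J.
  apply/eqP => e; have := off z; rewrite mem_iota; rewrite e in lt0.
  by move/(_ ltac:(lia)); lia.
have c1J : c z' != J.
  apply/eqP => e; have hi : z' + d.-1 < x J.+1.
    have cu : c (z' + d.-1) = c z' by apply: notneg_cnt => y yr; apply: zn'; lia.
    by rewrite ltnNge /x pos_galois -/c ?cu ?e ?ltnn //; lia.
  by move: mid'; rewrite /middle_run -/J; move: zl'; rewrite mulSn; lia.
(* If the window starts after [c z], it still reaches [c z'], which is at most [c z + Q]. *)
have [lt|ge] := leqP w (c z).
  by apply: other c0J g0; lia.
by apply: other c1J g1; lia.
Qed.

End Layout.
End Structure.

(** * Translation to sums of f *)

Section Translation.
Local Open Scope nat_scope.
Variables (d m s : nat) (f : nat -> int).

Let Q := m.*2 + s.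
Let k := (Q.+1).*2.
Let b := Q + d * Q.+2.
Let r := Q + d * s.
Let n := m * b + r.

Hypotheses (d_gt1 : 1 < d) (m_gt0 : 0 < m) (s_le1 : s <= 1).
Hypothesis f_pm : forall x, 1 <= x <= n -> f x = 1%R \/ f x = (-1)%R.

Definition minus (g : nat -> int) : pred nat := fun x => g x == (-1)%R.

Let neg := minus f.
Let c := cnt neg.
Let x := pos neg n.

Lemma Rset_iota i : Rset k d s i.+1 = iota (i * b).+1 r.
Proof.
rewrite /Rset /intv /b_ /r_ /k.
have -> : (d + 1) * Q.+1.*2 %/ 2 = (d + 1) * Q.+1.
  by rewrite -muln2 mulnA mulnK.
have -> : (d + 1) * Q.+1 + d - 1 = b by rewrite /b; nia.
have -> : Q.+1.*2 %/ 2 - 1 + d * s = r by rewrite /r; lia.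
by congr (iota _ _); nia.
Qed.

Lemma Tset_iota i : Tset k d s i.+1 = iota (i * b + r).+1 (b - r).
Proof.
rewrite /Tset /intv /b_ /k.
have -> : (d + 1) * Q.+1.*2 %/ 2 = (d + 1) * Q.+1.
  by rewrite -muln2 mulnA mulnK.
have -> : (d + 1) * Q.+1 + d - 1 = b by rewrite /b; nia.
have -> : Q.+1.*2 %/ 2 = Q.+1 by lia.
by rewrite subn1 /= mulSn /r; congr (iota _ _); lia.
Qed.

Lemma m_eq : m_ k s = m.
Proof. by rewrite /m_ /k /Q; lia. Qed.

Lemma fsum_minus (A : seq nat) : all (fun y => 1 <= y <= n) A ->
  fsum f A = ((size A)%:Z - ((count neg A).*2)%:Z)%R.
Proof.
rewrite /fsum; elim: A => [|y A IH] /=; first by rewrite big_nil.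
move=> /andP[yn An]; rewrite big_cons IH // /neg /minus.
by case: (f_pm yn) => -> /=; lia.
Qed.

Lemma fsum_zero (A : seq nat) : all (fun y => 1 <= y <= n) A -> size A = k ->
  fsum f A = 0%R <-> count neg A = Q.+1.
Proof. by move=> An sA; rewrite fsum_minus // sA /k; lia. Qed.

Lemma no_zero_block_balanced_free :
  (forall A, dk_block d k n A -> fsum f A <> 0%R) <-> balanced_free neg n d Q.
Proof.
split=> H A.
  move=> sA An szA /(fsum_zero An szA); apply: H; split=> //.
by case=> szA [An sA] /(fsum_zero An szA); apply: H.
Qed.

Lemma r_leb : r < b.
Proof. by rewrite /r /b ltn_add2l ltn_mul2l; lia. Qed.

Lemma R_in_n i : i <= m -> all (fun y => 1 <= y <= n) (iota (i * b).+1 r).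
Proof.
move=> im; apply/allP => y; rewrite mem_iota.
have : i * b <= m * b by rewrite leq_mul2r im orbT.
by rewrite /n; lia.
Qed.

Lemma T_in_n i : i < m -> all (fun y => 1 <= y <= n) (iota (i * b + r).+1 (b - r)).
Proof.
move=> im; apply/allP => y; rewrite mem_iota.
have : i.+1 * b <= m * b by rewrite leq_mul2r im orbT.
by have := r_leb; rewrite /n mulSn; lia.
Qed.

Lemma layout_counts :
  (forall i, i <= m -> count neg (iota (i * b).+1 r) = Q) ->
  (forall i, i < m -> count neg (iota (i * b + r).+1 (b - r)) = 0) ->
  layout neg d m s.
Proof.
move=> HR HT.
have H i : i <= m -> c (i * b) = i * Q -> c (i * b + r) = i.+1 * Q.
  move=> im cb; have := HR i im; rewrite cnt_iota.
  have := @cnt_mono neg (i * b) (i * b + r) (leq_addr _ _).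
  by rewrite -/c cb mulSn; lia.
have H0 i : i <= m -> c (i * b) = i * Q.
  elim: i => [//|i IH] im; rewrite -(H i (ltnW im) (IH (ltnW im))).
  have := HT i im; rewrite cnt_iota.
  have -> : i * b + r + (b - r) = i.+1 * b by rewrite mulSn; have := r_leb; lia.
  have := @cnt_mono neg (i * b + r) (i.+1 * b).
  by rewrite -/c mulSn; have := r_leb; lia.
by move=> i im; split; [exact: H0 | apply: H => //; exact: H0].
Qed.

Lemma layout_cntR i : layout neg d m s -> i <= m -> count neg (iota (i * b).+1 r) = Q.
Proof. by move=> lay im; rewrite cnt_iota; have [-> ->] := lay i im; rewrite mulSn addnK. Qed.

Lemma layout_cntT i : layout neg d m s -> i < m ->
  count neg (iota (i * b + r).+1 (b - r)) = 0.
Proof.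
move=> lay im; rewrite cnt_iota.
have -> : i * b + r + (b - r) = i.+1 * b by rewrite mulSn; have := r_leb; lia.
by have [_ ->] := lay i (ltnW im); have [-> _] := lay i.+1 im; rewrite subnn.
Qed.

Lemma count_minus0 (A : seq nat) : all (fun y => 1 <= y <= n) A ->
  count neg A = 0 <-> forall y, y \in A -> f y = 1%R.
Proof.
move=> An; split=> [c0 y yA|H].
  have [//|e] := f_pm (allP An y yA).
  have : has neg A by apply/hasP; exists y => //; rewrite /neg /minus e.
  by rewrite has_count c0.
by apply/eqP; rewrite -leqn0 leqNgt -has_count; apply/hasPn => y /H; rewrite /neg /minus => ->.
Qed.

Lemma R1_pluses i : i <= m -> R1 k d s f i.+1 = R_pluses neg d m s i.
Proof.
move=> im; rewrite /R1 Rset_iota; apply: eq_in_filter => y /(allP (R_in_n im)) yn.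
by rewrite /neg /minus; case: (f_pm yn) => ->.
Qed.

(** For [s = 0] each R has exactly [Q] points, so holding [Q] marks means being fully marked. *)
Lemma F1_layout : s = 0 -> F1 k d s f <-> layout neg d m s.
Proof.
move=> s0; have rQ : r = Q by rewrite /r s0 muln0 addn0.
rewrite /F1 m_eq addn1; split.
  case=> HR HT; apply: layout_counts => i im.
    have := HR i.+1 im; rewrite Rset_iota rQ => neg1.
    rewrite -[RHS](size_iota (i * b).+1 Q); apply/eqP; rewrite -all_count.
    by apply/allP => y /neg1; rewrite /neg /minus => ->.
  by apply/(count_minus0 (T_in_n im)); rewrite -Tset_iota; apply: HT.
move=> lay; split=> -[//|i] /= im y; rewrite ?Rset_iota ?Tset_iota.
  have : all neg (iota (i * b).+1 r).
    by rewrite all_count layout_cntR // size_iota rQ.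
  by move/allP => H /H /eqP.
by move: y; apply/(count_minus0 (T_in_n im)); apply: layout_cntT.
Qed.

Lemma F2_sums_layout : s = 1 ->
  ((forall i, 1 <= i <= m -> fsum f (Tset k d s i) = (size (Tset k d s i))%:Z%R) /\
   (forall i, 1 <= i <= m + 1 -> fsum f (Rset k d s i) = (d%:Z - (k %/ 2)%N%:Z + 1)%R))
  <-> layout neg d m s.
Proof.
move=> s1; have rQ : r = Q + d by rewrite /r s1 muln1.
rewrite addn1; split.
  case=> HT HR; apply: layout_counts => i im.
    have := HR i.+1 im; rewrite Rset_iota fsum_minus ?R_in_n // size_iota rQ /k.
    by lia.
  by have := HT i.+1 im; rewrite Tset_iota fsum_minus ?T_in_n //; lia.
move=> lay; split=> -[//|i] /= im; rewrite ?Rset_iota ?Tset_iota.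
  by rewrite fsum_minus ?T_in_n // layout_cntT // size_iota; lia.
by rewrite fsum_minus ?R_in_n // layout_cntR // size_iota rQ /k; lia.
Qed.

(** * The maximal blocks of value 1 around T_i *)

Section RunConditions.
Hypotheses (s1 : s = 1) (lay : layout neg d m s).

Lemma layout_cnt_n : cnt neg n = m.+1 * Q.
Proof. by have [_] := lay (leqnn m). Qed.

Let a0 i := (x (i.+1 * Q)).+1.
Let c0 i := (x (i.+1 * Q).+1).-1.

Lemma middle_bounds i : i < m ->
  [/\ i * b < x (i.+1 * Q), x (i.+1 * Q) <= i * b + r,
      i.+1 * b < x (i.+1 * Q).+1 & x (i.+1 * Q).+1 <= i.+1 * b + r].
Proof.
move=> im; have Q0 : 0 < Q by rewrite /Q; lia.
have := @pos_in_R neg d m s (ltnW d_gt1) m_gt0 s_le1 layout_cnt_n lay i (i.+1 * Q) (ltnW im).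
rewrite leqnn andbT ltn_mul2r Q0 /= => /(_ (ltnSn i)) /andP[l u].
have := @pos_in_R neg d m s (ltnW d_gt1) m_gt0 s_le1 layout_cnt_n lay i.+1 (i.+1 * Q).+1 im.
by rewrite ltnSn /= [i.+2 * _]mulSn -addn1 addnC leq_add2r => /(_ Q0) /andP[l' u'].
Qed.

(** A candidate contains T and no mark, so it cannot cross the marks on either side of T. *)
Lemma Tcand_sub i a e : i < m -> Tcand k d s f i.+1 a e -> a0 i <= a /\ e <= c0 i.
Proof.
move=> im [ae [_ [cov one]]]; have [l u l' u'] := middle_bounds im.
have rb := r_leb; have Q0 : 0 < Q by rewrite /Q; lia.
have Eb := mulSn i b.
have := cov (i * b + r).+1; rewrite Tset_iota mem_iota => /(_ ltac:(lia)) t1.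
have := cov (i.+1 * b); rewrite Tset_iota mem_iota => /(_ ltac:(lia)) t2.
have negx j : 0 < j -> j <= m.+1 * Q -> f (x j) <> 1%R.
  move=> j0 jn e1; have := @neg_pos neg n j j0.
  by rewrite layout_cnt_n /neg /minus -/neg -/x e1 => /(_ jn).
split; rewrite leqNgt; apply/negP => lt.
  apply: (negx (i.+1 * Q)); [by rewrite muln_gt0 | by rewrite leq_mul2r; lia | apply: one].
  by rewrite /a0 in lt; lia.
apply: (negx (i.+1 * Q).+1) => //; last by apply: one; rewrite /c0 in lt; lia.
by apply: (@leq_trans (i.+2 * Q)); [rewrite ltn_mul2r Q0 ltnSn | rewrite leq_mul2r; lia].
Qed.

Lemma Tcand_middle i : i < m -> Tcand k d s f i.+1 (a0 i) (c0 i).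
Proof.
move=> im; have [l u l' u'] := middle_bounds im.
have rb := r_leb; have Eb := mulSn i b; rewrite /a0 /c0.
split; first by lia.
split=> [y yr|].
  by rewrite addn1 !mem_cat !Rset_iota Tset_iota !mem_iota; lia.
split=> y; first by rewrite Tset_iota mem_iota; lia.
move=> yr; have [//|e] : f y = 1%R \/ f y = (-1)%R.
  apply: f_pm; have : i.+1 * b <= m * b by rewrite leq_mul2r im orbT.
  by rewrite /n; lia.
have := @between_notneg neg n (i.+1 * Q) y.
by rewrite -/x /neg /minus e => /(_ ltac:(lia)).
Qed.

Lemma Tcal_middle i : i < m -> Tcal k d s f i.+1 (a0 i) (c0 i).
Proof.
move=> im; have cand := Tcand_middle im; split=> // a e cand' sub.
have [ha he] := Tcand_sub im cand'; have [le _] := cand.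
have h1 := sub (a0 i); have h2 := sub (c0 i); have [le' _] := cand'.
by have [-> ->] : a = a0 i /\ e = c0 i by lia.
Qed.

(** Reduces the quantification over maximal blocks in [F2] to a single interval. *)
Lemma Tcal_intv i a e : i < m -> Tcal k d s f i.+1 a e -> intv a e = intv (a0 i) (c0 i).
Proof.
move=> im [cand maxi]; have [ha he] := Tcand_sub im cand.
by symmetry; apply: maxi (Tcand_middle im) _ => y; lia.
Qed.

Lemma mem_middle i y : i < m ->
  (y \in intv (a0 i) (c0 i)) = (x (i.+1 * Q) < y < x (i.+1 * Q).+1).
Proof.
move=> im; have [l u l' u'] := middle_bounds im; have Eb := mulSn i b.
by rewrite /intv mem_iota /a0 /c0; have := r_leb; lia.
Qed.

Lemma size_middle_outside i : i < m ->
  size [seq y <- intv (a0 i) (c0 i) | y \notin Tset k d s i.+1]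
    = middle_run neg d m s i - (b - r).
Proof.
move=> im; have [l u l' u'] := middle_bounds im; have Eb := mulSn i b.
have rb := r_leb.
have sz : size (intv (a0 i) (c0 i)) = middle_run neg d m s i.
  by rewrite size_iota /a0 /c0 /middle_run -/Q -/b -/r -/n -/x; lia.
rewrite -sz size_filter.
have := count_predC (mem (Tset k d s i.+1)) (intv (a0 i) (c0 i)).
have -> : count (mem (Tset k d s i.+1)) (intv (a0 i) (c0 i)) = b - r.
  rewrite -size_filter -(size_iota (i * b + r).+1 (b - r)); apply: perm_size.
  apply: uniq_perm; rewrite ?filter_uniq ?iota_uniq // => y.
  by rewrite mem_filter mem_middle // Tset_iota /= !mem_iota; lia.
have -> : count (fun y => y \notin Tset k d s i.+1) (intv (a0 i) (c0 i))
        = count (predC (mem (Tset k d s i.+1))) (intv (a0 i) (c0 i)) by [].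
by move=> <-; rewrite addKn.
Qed.

Lemma F2_run_conditions :
  ((forall i, 1 <= i <= m -> ~ is_block (R1 k d s f i) ->
     forall a e, Tcal k d s f i a e ->
       d <= size [seq y <- intv a e | y \notin Tset k d s i]) /\
   (forall i, 1 <= i <= m -> is_block (R1 k d s f i) ->
     forall a e, Tcal k d s f i a e ->
       (forall y, y \in Rset k d s i -> y \notin intv a e) ->
       is_block (R1 k d s f (i + 1)) /\
       size [seq y <- iota 1 n | (f y == (-1)%R) &&
                 all (fun z => z < y) (R1 k d s f i) &&
                 all (fun z => y < z) (R1 k d s f (i + 1))] <= k %/ 2 - 1))
  <-> run_conditions neg d m s.
Proof.
have kQ : k %/ 2 - 1 = Q by rewrite /k; lia.
rewrite kQ; split.
  case=> H3 H4; rewrite /run_conditions -/Q -/b -/r -/n -/x => i im; split=> blk.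
    rewrite -size_middle_outside //; apply: (H3 i.+1 _ _ _ _ (Tcal_middle im)) => //.
    by rewrite R1_pluses // ltnW.
  move=> off; have := H4 i.+1 im; rewrite addn1 !R1_pluses ?(ltnW im) //.
  apply; [exact: blk | exact: Tcal_middle |].
  by move=> y; rewrite Rset_iota mem_middle //; exact: off.
move=> cond; split=> -[//|i] /= im; have [H3 H4] := cond i im.
  rewrite R1_pluses ?(ltnW im) // => blk a e /(Tcal_intv im) ->.
  by rewrite size_middle_outside //; apply: H3.
rewrite addn1 !R1_pluses ?(ltnW im) // => blk a e /(Tcal_intv im) -> off.
by apply: H4 => // y yR; rewrite -mem_middle //; apply: off; rewrite Rset_iota.
Qed.

End RunConditions.

(** The coefficient of [d] is [m * Q + 2 * m + s = m.+1 * Q]. *)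
Lemma n_eq : n = (d + 1) * (m.+1 * Q).
Proof.
rewrite /n /b /r /Q; have : s = 0 \/ s = 1 by lia.
by case=> ->; nia.
Qed.

Lemma inFplus_iff : inFplus k d s n f <->
  cnt neg n = m.+1 * Q /\ balanced_free neg n d Q.
Proof.
have d0 : 0 < d by lia.
have Q1 : 1 < Q by rewrite /Q; lia.
have nlarge : 2 * (Q.+1).*2 <= n.
  by rewrite n_eq; nia.
have spread_iff : cnt neg n = m.+1 * Q ->
    balanced_free neg n d Q <-> spread neg n d Q.
  move=> cn; split=> [bf|spr A sA An szA cA].
    (* The bound [3 * cnt neg n <= n] comes down to [3 <= d + 1]. *)
    by apply: balanced_free_spread => //; rewrite cn n_eq leq_mul2r; lia.
  have := spread_chain d0 spr sA An cA.
  by have := count_predC neg A; rewrite szA cA; lia.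
have layout_iff : inFplus k d s n f <-> layout neg d m s /\ (s = 1 -> run_conditions neg d m s).
  have [s0|s1] : s = 0 \/ s = 1 by lia.
    split=> [[/(_ s0) F _]|[lay _]]; first by split; [apply/F1_layout | lia].
    by split; [move=> _; apply/F1_layout | lia].
  split=> [[_ /(_ s1)]|[lay /(_ s1) cond]].
    rewrite /F2 m_eq => -[H1 [H2 H34]].
    have lay : layout neg d m s by apply/F2_sums_layout.
    by split=> // _; apply/F2_run_conditions.
  split=> [|_]; first by lia.
  have /(F2_sums_layout s1)[H1 H2] := lay.
  by move/(F2_run_conditions s1 lay): cond; rewrite /F2 m_eq.
rewrite layout_iff; split=> [[lay cond]|[cn bf]].
  have cn := layout_cnt_n lay; split=> //; apply/spread_iff => //.
  have [s0|s1] : s = 0 \/ s = 1 by lia.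
    exact: layout_spread0.
  exact: run_conditions_spread (cond s1).
have spr := (spread_iff cn).1 bf.
have lay : layout neg d m s by apply: spread_layout.
by split=> // s1; apply: spread_run_conditions.
Qed.

(** The sum is [n - 2 * cnt neg n], so by [n_eq] its value prescribes [cnt neg n = m.+1 * Q]. *)
Lemma inFplus_sum_iff : inFplus k d s n f <->
  fsum f (iota 1 n) = ((d - 1) * (m.+1 * Q))%:Z%R /\
  forall A, dk_block d k n A -> fsum f A <> 0%R.
Proof.
rewrite inFplus_iff -no_zero_block_balanced_free fsum_minus; last first.
  by apply/allP => y; rewrite mem_iota; lia.
rewrite size_iota -/(cnt neg n) n_eq.
have [e eE] : exists e, e = m.+1 * Q by eexists.
have [g gE] : exists g, d = g.+1 by exists d.-1; lia.
by split=> -[H1 H2]; split=> //; move: H1; rewrite -eE gE subn1 addn1 !mulSn /=; lia.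
Qed.

End Translation.

(** * Both signs, and the formula for n *)

Local Open Scope ring_scope.

Lemma fsum_opp (f : nat -> int) A : fsum (fun x => - f x) A = - fsum f A.
Proof. by rewrite /fsum sumrN. Qed.

Theorem theorem3p7 (k d n s : nat) (f : nat -> int) :
  (0 < k)%N -> (0 < d)%N -> (0 < n)%N ->
  ~~ odd k -> (6 <= k)%N -> (2 <= d)%N ->
  (s <= 1)%N -> (s %% 2 = ((k - 2) %/ 2) %% 2)%N ->
  (n%:R : rat) = (d + 1)%:R / 8%:R *
                 ((k%:R) ^+ 2 - 2%:R * s%:R * k%:R + 4%:R * s%:R - 4%:R) ->
  (forall x, (1 <= x <= n)%N -> f x = 1 \/ f x = -1) ->
  ( ((`|fsum f (iota 1%N n)|)%:~R : rat) = (d - 1)%:R / (d + 1)%:R * n%:R /\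
    (forall A, dk_block d k n A -> fsum f A <> 0) )
  <-> inF k d s n f.
Proof.
move=> _ _ _ k_even k_ge6 d_gt1 s_le1 s_par n_rat f_pm.
(* The parity condition makes [k - 2 * s - 2] divisible by 4, and [6 <= k] makes the quotient
   positive. *)
have [m m_gt0 kE] : exists2 m, (0 < m)%N & k = ((m.*2 + s).+1).*2.
  by exists (m_ k s); rewrite /m_; lia.
set M := (m.+1 * (m.*2 + s))%N.
(* Here [k^2 - 2sk + 4s - 4 = (k - 2)(k + 2 - 2s) = 8(2m + s)(m + 1)]. *)
have nM : n = ((d + 1) * M)%N.
  apply/eqP; rewrite -(eqr_nat rat) n_rat kE /M.
  rewrite -!muln2 -(addn1 m) -(addn1 (m * 2 + s)) !(natrM, natrD).
  by apply/eqP; field.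
have sumE : ((`|fsum f (iota 1%N n)|)%:~R : rat) = (d - 1)%:R / (d + 1)%:R * n%:R
    <-> `|fsum f (iota 1%N n)| = ((d - 1) * M)%:Z.
  have -> : (d - 1)%:R / (d + 1)%:R * n%:R = (((d - 1) * M)%N%:Z)%:~R :> rat.
    have d1 : (d + 1)%:R != 0 :> rat by rewrite pnatr_eq0 addn1.
    by rewrite nM -pmulrn !natrM mulrA mulfVK.
  by split=> [/intr_inj|->].
have nE := n_eq d_gt1 m_gt0 s_le1; rewrite -/M -nM in nE.
have plus g : (forall x, (1 <= x <= n)%N -> g x = 1 \/ g x = -1) ->
    inFplus k d s n g <-> fsum g (iota 1%N n) = ((d - 1) * M)%:Z /\
      forall A, dk_block d k n A -> fsum g A <> 0.
  by move=> g_pm; have := @inFplus_sum_iff d m s g d_gt1 m_gt0 s_le1; rewrite -kE nE; apply.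
have fN_pm x : (1 <= x <= n)%N -> - f x = 1 \/ - f x = -1.
  by move=> /f_pm[->|->]; [right | left]; rewrite ?opprK.
rewrite /inF (plus f f_pm) (plus _ fN_pm) fsum_opp sumE.
split=> [[sum_f free]|].
  (* The sign of the sum decides between [f] and its negative. *)
  have [f0|f0] := leP 0 (fsum f (iota 1%N n)).
    by left; split=> //; rewrite -sum_f ger0_norm.
  right; split=> [|A /free]; first by rewrite -sum_f ltr0_norm.
  by rewrite fsum_opp => nz /eqP; rewrite oppr_eq0 => /eqP.
case=> -[sum_f free]; split=> //.
- by rewrite sum_f ger0_norm.
- by rewrite -normrN sum_f ger0_norm.
by move=> A /free; rewrite fsum_opp => nz f0; apply: nz; rewrite f0 oppr0.
Qed.
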